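(* Let $1<p<\infty$. Then $$D\left(\left(\oplus_{n=1}^\infty \ell^\infty_n\right)_p\right)=1^+ .$$
   Context: $\ell^\infty_n$ denotes the $n$-dimensional space $\mathbb{R}^n$ with the maximum norm $\|\cdot\|_\infty$. The space $\left(\oplus_{n=1}^\infty \ell^\infty_n\right)_p$ is the $\ell_p$-direct sum: all sequences $x=\{x_n\}_{n=1}^\infty$ with $x_n\in \ell^\infty_n$ and $\|x\|=\left(\sum_{n=1}^\infty\|x_n\|_\infty^p\right)^{1/p}<\infty$. A metric space is locally finite if each ball of finite radius in it has finite cardinality. For $1\le C<\infty$, a map $f:(A,d_A)\to(Y,d_Y)$ between metric spaces is a $C$-bilipschitz embedding if there exists $r>0$ such that $r\,d_A(u,v)\le d_Y(f(u),f(v))\le rC\,d_A(u,v)$ for all $u,v\in A$. A bilipschitz embedding is a map that is $C$-bilipschitz for some such $C$. The distortion of $f$ is the smallest $C$ for which such an $r$ exists. For a Banach space $X$ and a real number $\alpha\ge 1$: (1) $D(X)\le\alpha$ means that, for every $C\in[1,\infty)$ and every locally finite metric space $A$ all of whose finite subsets admit bilipschitz embeddings into $X$ with distortions $\le C$, the space $A$ itself admits a bilipschitz embedding into $X$ with distortion $\le\alpha\cdot C$. (2) $D(X)=\alpha^+$ means that $D(X)\le\alpha+\varepsilon$ holds for every $\varepsilon>0$, while $D(X)\le\alpha$ does not hold. *)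

(* Defs.v *)
From HB Require Import structures.
From mathcomp Require Import all_boot all_order all_algebra.
From mathcomp Require Import all_classical all_reals all_analysis.

Set Implicit Arguments.
Unset Strict Implicit.
Unset Printing Implicit Defensive.

Import Order.TTheory GRing.Theory Num.Theory.
Import numFieldNormedType.Exports.

Local Open Scope classical_set_scope.
Local Open Scope ring_scope.

Section lpn.
Context {R : realType} (p : R) (p1 : 1 <= p).
Implicit Types (u v w : nat -> R).

(* Meant for nonnegative sequences: [powR] is not absolute-value based
   ([x `^ p = 1] for [x < 0]). *)
Definition lpn u : \bar R := ((\sum_(n <oo) (u n `^ p)%:E) `^ p^-1)%E.

Let p0 : 0 < p. Proof. exact: lt_le_trans p1. Qed.

Lemma lpn_ge0 u : (0 <= lpn u)%E.
Proof. exact: poweR_ge0. Qed.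

Lemma lpn_sum_ge0 u : (0 <= \sum_(n <oo) (u n `^ p)%:E)%E.
Proof. by apply: nneseries_ge0 => n _ _; rewrite lee_fin powR_ge0. Qed.

Lemma lpn_leP u (M : R) : 0 <= M ->
  (lpn u <= M%:E)%E = (\sum_(n <oo) (u n `^ p)%:E <= (M `^ p)%:E)%E.
Proof.
move=> M0; apply/idP/idP => h.
- have := @gt0_ler_poweR R p (ltW p0) (lpn u) M%:E.
  rewrite !in_itv/= !leey !lpn_ge0 lee_fin M0 => /(_ isT isT h).
  by rewrite /lpn -poweRrM mulVf ?gt_eqF// poweRe1// lpn_sum_ge0.
- have pV0 : 0 <= p^-1 by rewrite invr_ge0 ltW.
  have := @gt0_ler_poweR R p^-1 pV0 _ _ _ _ h.
  rewrite !in_itv/= !leey !lpn_sum_ge0 lee_fin powR_ge0 => /(_ isT isT).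
  by rewrite -powRrM mulfV ?gt_eqF// powRr1.
Qed.

Lemma lpn_le u v : (forall n, 0 <= u n <= v n) -> (lpn u <= lpn v)%E.
Proof.
move=> uv; apply: gt0_ler_poweR.
- by rewrite invr_ge0 ltW.
- by rewrite in_itv/= leey lpn_sum_ge0.
- by rewrite in_itv/= leey lpn_sum_ge0.
- apply: lee_nneseries => [n _ _|n _]; rewrite lee_fin ?powR_ge0//.
  have /andP[u0 le] := uv n.
  by apply: ge0_ler_powR => //; rewrite ?nnegrE ?(ltW p0)// (le_trans u0).
Qed.

Lemma lpn_triangle u v w : (forall n, 0 <= u n) -> (forall n, 0 <= v n) ->
  (forall n, 0 <= w n <= u n + v n) -> (lpn w <= lpn u + lpn v)%E.
Proof.
move=> u0 v0 wuv; apply: le_trans (lpn_le wuv) _.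
have e f : (forall n, 0 <= f n) -> lpn f = Lnorm counting p%:E (EFin \o f).
  move=> f0; rewrite Lnorm_counting//; congr (_ `^ _)%E.
  by apply: eq_eseriesr => n _; rewrite /= ger0_norm.
rewrite !e// => [|n]; last by rewrite addr_ge0.
exact: (@minkowski_EFin _ _ R counting u v p).
Qed.

Lemma lpn_coord u n : (forall k, 0 <= u k) -> ((u n)%:E <= lpn u)%E.
Proof.
move=> u0; have [->|fin] := eqVneq (lpn u) +oo%E; first by rewrite leey.
have [M M0 e] : exists2 M, 0 <= M & lpn u = M%:E.
  exists (fine (lpn u)); first by rewrite fine_ge0// lpn_ge0.
  by rewrite fineK// ge0_fin_numE ?lpn_ge0// ltey.
have : (lpn u <= M%:E)%E by rewrite e.
rewrite lpn_leP// e lee_fin => h.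
have : ((u n `^ p)%:E <= (M `^ p)%:E)%E.
  apply: le_trans h; apply: le_trans (nneseries_lim_ge n.+1 _) => [|k _ _];
    last by rewrite lee_fin powR_ge0.
  rewrite big_nat_recr//= leeDr// sume_ge0// => k _.
  by rewrite lee_fin powR_ge0.
rewrite lee_fin => /(@ge0_ler_powR _ p^-1).
rewrite -!powRrM mulfV ?gt_eqF// !powRr1//; apply; rewrite ?nnegrE ?powR_ge0//.
by rewrite invr_ge0 ltW.
Qed.

Definition lptrunc N u n := if (n < N)%N then u n else 0.

Lemma lpn_trunc_sum N u : (\sum_(n <oo) (lptrunc N u n `^ p)%:E =
  \sum_(0 <= n < N) (u n `^ p)%:E)%E.
Proof.
rewrite (nneseries_split 0 N); last by move=> k _; rewrite lee_fin powR_ge0.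
rewrite add0n [X in (_ + X)%E]eseries0 ?adde0; last first.
  by move=> i Ni _; rewrite /lptrunc ltnNge Ni/= powR0// gt_eqF.
by apply: eq_big_nat => n /andP[_ nN]; rewrite /lptrunc nN.
Qed.

Lemma lpn_trunc_le N u : (forall n, 0 <= u n) -> (lpn (lptrunc N u) <= lpn u)%E.
Proof.
by move=> u0; apply: lpn_le => n; rewrite /lptrunc; case: ifP; rewrite !lexx ?u0.
Qed.

Lemma lpn_trunc_sup u (M : R) : 0 <= M ->
  (forall N, lpn (lptrunc N u) <= M%:E)%E -> (lpn u <= M%:E)%E.
Proof.
move=> M0 h; rewrite lpn_leP//; apply: lime_le.
  by apply: is_cvg_nneseries => n _ _; rewrite lee_fin powR_ge0.
by apply: nearW => N; rewrite -lpn_trunc_sum -lpn_leP.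
Qed.

Lemma lpn_trunc_small N u (e : R) : 0 <= e -> (forall n, 0 <= u n) ->
  (forall n, (n < N)%N -> u n <= e / (N.+1%:R `^ p^-1)) ->
  (lpn (lptrunc N u) <= e%:E)%E.
Proof.
move=> e0 u0 h; rewrite lpn_leP// lpn_trunc_sum sumEFin lee_fin.
apply: (@le_trans _ _ (\sum_(0 <= i < N) (e `^ p / N.+1%:R))).
  rewrite big_nat_cond [leRHS]big_nat_cond; apply: ler_sum => n.
  rewrite andbT => /andP[_ nN].
  have -> : e `^ p / N.+1%:R = (e / (N.+1%:R `^ p^-1)) `^ p.
    rewrite powRM// ?invr_ge0 ?powR_ge0//; congr (_ * _).
    by rewrite -powRN -powRrM mulNr mulVf ?gt_eqF// powR_inv1.
  by apply: ge0_ler_powR; rewrite ?nnegrE ?(ltW p0) ?divr_ge0 ?powR_ge0 ?h.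
rewrite sumr_const_nat subn0 -[leLHS]mulr_natr -mulrA ler_piMr ?powR_ge0//.
by rewrite mulrC ler_pdivrMr// mul1r ler_nat.
Qed.

Lemma lpnZ (c : R) u : 0 <= c -> (forall n, 0 <= u n) ->
  lpn (fun n => c * u n) = (c%:E * lpn u)%E.
Proof.
move=> c0 u0; rewrite /lpn.
under eq_eseriesr do rewrite powRM// EFinM.
rewrite nneseriesZl; last by move=> n _; rewrite lee_fin powR_ge0.
rewrite poweRM ?lee_fin ?powR_ge0 ?lpn_sum_ge0//.
by rewrite poweR_EFin -powRrM mulfV ?gt_eqF// powRr1.
Qed.

Lemma lpn0 : lpn (fun=> 0) = 0%E.
Proof.
rewrite /lpn eseries0 ?poweR0r// ?gt_eqF ?invr_gt0// => i _ _.
by rewrite powR0// gt_eqF.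
Qed.

End lpn.

(* The l_p-direct sum of Banach spaces E 0, E 1, ... ; the membership condition
   (and the norm, see [lpsum_normE]) is (\sum_n ||x n||^p)^(1/p) < +oo. *)
Record lpsum (R : realType) (p : R) (p1 : 1 <= p)
    (E : nat -> completeNormedModType R) := LpSum {
  lpcoord :> forall n, E n ;
  lpcoordP : (lpn p (fun n => `|lpcoord n|)%R < +oo)%E }.

Arguments LpSum {R p} p1 {E lpcoord}.

Section lpsum.
Context (R : realType) (p : R) (p1 : 1 <= p).
Context (E : nat -> completeNormedModType R).
Local Notation X := (lpsum p1 E).
Implicit Types (x y z : X).

Lemma lpsum_ext x y : (forall n, x n = y n) -> x = y.
Proof.
case: x y => [x xP] [y yP]/= xy.
have exy : x = y by apply: functional_extensionality_dep.
by rewrite exy in xP *; congr LpSum; exact: Prop_irrelevance.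
Qed.

HB.instance Definition _ := gen_eqMixin X.
HB.instance Definition _ := gen_choiceMixin X.

Let zeroP : (lpn p (fun n => `|0 : E n|)%R < +oo)%E.
Proof.
by under [X in lpn p X]eq_fun do rewrite normr0; rewrite lpn0.
Qed.

Let addP x y : (lpn p (fun n => `|x n + y n|)%R < +oo)%E.
Proof.
apply: (@le_lt_trans _ _ (lpn p (fun n => `|x n|)%R + lpn p (fun n => `|y n|)%R)%E).
  by apply: lpn_triangle => // n; rewrite normr_ge0 ler_normD.
by rewrite lte_add_pinfty// lpcoordP.
Qed.

Let oppP x : (lpn p (fun n => `|- x n|)%R < +oo)%E.
Proof. by under [X in lpn p X]eq_fun do rewrite normrN; exact: lpcoordP. Qed.

Let scaleP (a : R) x : (lpn p (fun n => `|a *: x n|)%R < +oo)%E.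
Proof.
under [X in lpn p X]eq_fun do rewrite normrZ.
by rewrite lpnZ// lte_mul_pinfty// ?lee_fin ?lpcoordP.
Qed.

Let zero : X := LpSum p1 zeroP.
Let opp x : X := LpSum p1 (oppP x).
Let add x y : X := LpSum p1 (addP x y).
Let scale (a : R) x : X := LpSum p1 (scaleP a x).

Let addA : associative add.
Proof. by move=> x y z; apply: lpsum_ext => n /=; rewrite addrA. Qed.
Let addC : commutative add.
Proof. by move=> x y; apply: lpsum_ext => n /=; rewrite addrC. Qed.
Let add0 : left_id zero add.
Proof. by move=> x; apply: lpsum_ext => n /=; rewrite add0r. Qed.
Let addN : left_inverse zero opp add.
Proof. by move=> x; apply: lpsum_ext => n /=; rewrite addNr. Qed.

HB.instance Definition _ := GRing.isZmodule.Build X addA addC add0 addN.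

Let scaleA a b x : scale a (scale b x) = scale (a * b) x.
Proof. by apply: lpsum_ext => n /=; rewrite scalerA. Qed.
Let scale1 : left_id 1 scale.
Proof. by move=> x; apply: lpsum_ext => n /=; rewrite scale1r. Qed.
Let scaleDr : right_distributive scale +%R.
Proof. by move=> a x y; apply: lpsum_ext => n /=; rewrite scalerDr. Qed.
Let scaleDl x : {morph scale^~ x : a b / a + b}.
Proof. by move=> a b; apply: lpsum_ext => n /=; rewrite scalerDl. Qed.

HB.instance Definition _ :=
  GRing.Zmodule_isLmodule.Build R X scaleA scale1 scaleDr scaleDl.

Definition lpsum_norm x : R := fine (lpn p (fun n => `|x n|)%R).

Lemma lpsum_normE x : (lpsum_norm x)%:E = lpn p (fun n => `|x n|)%R.
Proof. by rewrite fineK// ge0_fin_numE ?lpn_ge0// lpcoordP. Qed.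

Let norm_triangle x y : lpsum_norm (x + y) <= lpsum_norm x + lpsum_norm y.
Proof.
rewrite -lee_fin EFinD !lpsum_normE.
by apply: lpn_triangle => // n; rewrite normr_ge0 ler_normD.
Qed.

Let normZ (a : R) x : lpsum_norm (a *: x) = `|a| * lpsum_norm x.
Proof.
apply: EFin_inj; rewrite EFinM !lpsum_normE -lpnZ//.
by congr lpn; apply/funext => n; rewrite /= normrZ.
Qed.

Let norm_eq0 x : lpsum_norm x = 0 -> x = 0.
Proof.
move=> x0; apply: lpsum_ext => n; apply/normr0_eq0/eqP.
rewrite eq_le normr_ge0 andbT -lee_fin -x0 lpsum_normE.
exact: (@lpn_coord _ _ p1 (fun n => `|x n|)).
Qed.

HB.instance Definition _ :=
  Lmodule_isNormed.Build R X norm_triangle normZ norm_eq0.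

Lemma lpsum_normrE x : `|x| = lpsum_norm x. Proof. by []. Qed.

Lemma lpsum_coordB x y n : (x - y) n = x n - y n. Proof. by []. Qed.

Lemma lpsum_complete (F : set_system X) : ProperFilter F -> cauchy F -> cvg F.
Proof.
move=> FF /cauchy_ballP Fc.
have Fcn n : cvg ((fun x : X => x n) @ F).
  apply: cauchy_cvg; apply/cauchy_ballP => e e0.
  rewrite near_map2.
  apply: filterS (Fc e e0) => -[x y]/=; rewrite -!ball_normE/=.
  apply: le_lt_trans.
  rewrite -lee_fin lpsum_normrE lpsum_normE -lpsum_coordB.
  exact: (@lpn_coord _ _ p1 (fun n => `|(x - y) n|)).
pose l n : E n := lim ((fun x : X => x n) @ F).
have H (e : R) : 0 < e ->
    \forall x \near F, (lpn p (fun n => `|(x : X) n - l n|)%R <= e%:E)%E.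
  move=> e0; have e20 : 0 < e / 2 by rewrite divr_gt0.
  have : \forall x \near F, \forall y \near F, ball x (e / 2) y.
    by apply: nearP_dep; exact: Fc.
  apply: filterS => x xF.
  apply: lpn_trunc_sup => //; first exact: ltW.
  move=> N; pose d := (e / 2) / (N.+1%:R `^ p^-1).
  have d0 : 0 < d by rewrite divr_gt0// powR_gt0.
  have lN : \forall y \near F, forall n, (n < N)%N -> `|(y : X) n - l n| <= d.
    have : \forall y \near F, forall i : 'I_N, `|(y : X) i - l i| <= d.
      apply: filter_forall => i.
      have /cvgrPdist_le/(_ _ d0) := Fcn i.
      rewrite near_simpl; apply: filterS => y; by rewrite distrC.
    by apply: filterS => y h n nN; exact: (h (Ordinal nN)).
  near F => y.
  rewrite (splitr e) EFinD.
  apply: (@le_trans _ _ (lpn p (lptrunc N (fun n => `|x n - y n|)%R) +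
      lpn p (lptrunc N (fun n => `|y n - l n|)%R))%E).
    apply: lpn_triangle => // n; rewrite /lptrunc; case: ifP => // _.
    - by rewrite normr_ge0 ler_distD.
    - by rewrite addr0 lexx.
  apply: leeD.
  - apply: le_trans (lpn_trunc_le _ _ _) _ => //.
    have : ball x (e / 2) y by near: y.
    by rewrite -ball_normE/= lpsum_normrE -lte_fin lpsum_normE => /ltW.
  - by apply: lpn_trunc_small; rewrite ?(ltW e20)//; near: y.
have lP : (lpn p (fun n => `|l n|)%R < +oo)%E.
  near F => x.
  apply: (@le_lt_trans _ _ (lpn p (fun n => `|x n|)%R +
     lpn p (fun n => `|x n - l n|)%R)%E).
    apply: lpn_triangle => // n; rewrite normr_ge0/=.
    have {1}-> : l n = x n - (x n - l n) by rewrite opprB addrC subrK.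
    exact: ler_normB.
  rewrite lte_add_pinfty ?lpcoordP//; apply: (@le_lt_trans _ _ 1%:E).
    by near: x; exact: H.
  by rewrite ltey.
apply/cvg_ex; exists (LpSum p1 lP : X).
apply/cvgrPdist_le => e e0; near=> x.
rewrite distrC -lee_fin lpsum_normrE lpsum_normE.
by near: x; exact: H.
Unshelve. all: by end_near. Qed.

HB.instance Definition _ := Uniform_isComplete.Build X lpsum_complete.

End lpsum.

HB.instance Definition _ (R : realType) (m n : nat) :=
  Complete.on 'M[R]_(m, n).

(* The library's norm on row vectors, [mx_norm], is the maximum norm. *)
Definition ell_infty (R : realType) (n : nat) : completeNormedModType R :=
  'rV[R]_n.

Section distortion.
Context {R : realType}.

Definition locally_finite (A : metricType R) : Prop :=
  forall (a : A) (r : R), finite_set (ball a r).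

(* Maps from a subset S of A are represented by total functions on A whose
   values outside S are ignored. *)
Definition bilipschitz_with {A : metricType R} {X : normedModType R}
    (S : set A) (C : R) (f : A -> X) : Prop :=
  1 <= C /\
  exists2 r : R, 0 < r &
    forall u v, S u -> S v ->
      r * mdist u v <= `|f u - f v| <= r * C * mdist u v.

(* D is the smallest constant C >= 1 for which f is C-bilipschitz on S. *)
Definition distortion_is {A : metricType R} {X : normedModType R}
    (S : set A) (f : A -> X) (D : R) : Prop :=
  bilipschitz_with S D f /\
  forall C, bilipschitz_with S C f -> D <= C.

Definition embeds_with_distortion_le {A : metricType R} (S : set A)
    (X : normedModType R) (C : R) : Prop :=
  exists (f : A -> X) (D : R), distortion_is S f D /\ D <= C.

(* D(X) <= alpha *)
Definition D_le (X : completeNormedModType R) (alpha : R) : Prop :=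
  forall (C : R) (A : metricType R), 1 <= C -> locally_finite A ->
    (forall S : set A, finite_set S -> embeds_with_distortion_le S X C) ->
    embeds_with_distortion_le [set: A] X (alpha * C).

(* D(X) = alpha^+ *)
Definition D_eq_plus (X : completeNormedModType R) (alpha : R) : Prop :=
  (forall eps : R, 0 < eps -> D_le X (alpha + eps)) /\ ~ D_le X alpha.

End distortion.

(* Main.v *)
(* Every finite metric space embeds isometrically into some l^oo_n (Fréchet), so
   the hypothesis on finite subsets is void for this space X and everything is
   about locally finite spaces A.

   D(X) <= 1 + eps: with a base point o, let c(u) be a point of the unit sphere of
   l_p moving very slowly with ln (1 + d(o, u)), along a path through the unit
   vectors. Put f(u)_n = c(u)_n T_n(u), T_n being a Fréchet embedding adapted to
   the ball where c(u)_n can be nonzero. Then ||f u - f v|| differs from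
   ||c(u)||_p d(u, v) = d(u, v) by at most ||c(u) - c(v)||_p d(o, v), which is
   small compared to d(u, v).

   D(X) <= 1 fails: as 1 < p, the equality case of Minkowski's inequality makes
   an isometric embedding scale each coordinate proportionally along geodesics.
   In a locally finite space with a chain of growing levels, where points of the
   same level are at distance 2 with midpoints in the next level, this forces
   arbitrarily large equilateral sets into a fixed l^oo_n, whereas such a set with
   a midpoint has at most 2^n elements. *)

Require Import Defs.
From HB Require Import structures.
From mathcomp Require Import all_boot all_order all_algebra.
From mathcomp Require Import all_classical all_reals all_analysis.
From mathcomp Require Import ring lra zify.

Set Implicit Arguments.
Unset Strict Implicit.
Unset Printing Implicit Defensive.

Import Order.TTheory GRing.Theory Num.Theory.
Import numFieldNormedType.Exports.

Local Open Scope classical_set_scope.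
Local Open Scope ring_scope.

(** * Minkowski's equality case *)

Lemma lt_ln_subr1 (R : realType) (t : R) : 0 < t -> t != 1 -> ln t < t - 1.
Proof.
move=> t0 t1; rewrite ltrBrDl -[ltRHS]lnK ?posrE//.
by apply: expR_gt1Dx; rewrite ln_eq0.
Qed.

(** A strict Bernoulli inequality. With [z] the left side, the bounds [ln z - ln x <= z / x - 1] and
    [- ln x < x^-1 - 1], the latter weighted by [p - 1], add up to [ln z < p * ln x], because the
    right sides cancel. *)
Lemma powR_gt_tangent (R : realType) (p x : R) :
  1 < p -> 0 <= x -> x != 1 -> 1 + p * (x - 1) < x `^ p.
Proof.
move=> p1; rewrite le0r => /orP[/eqP-> _|x0 x1].
  by rewrite powR0 ?gt_eqF ?(lt_trans ltr01)//; lra.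
have [z0|z0] := leP (1 + p * (x - 1)) 0; first exact/(le_lt_trans z0)/powR_gt0.
rewrite -ltr_ln ?posrE ?powR_gt0// ln_powR; set z := 1 + _ in z0 *.
have xV0 : 0 < x^-1 by rewrite invr_gt0.
have lnz : ln z - ln x <= z / x - 1.
  rewrite -ln_div ?posrE//.
  by have := @le_ln1Dx R (z / x - 1); rewrite [1 + _]addrC subrK; apply; rewrite ltrBrDr addNr divr_gt0.
have lnV : - ln x < x^-1 - 1.
  by rewrite -lnV ?posrE//; apply: lt_ln_subr1; rewrite // invr_eq1.
have : (p - 1) * - ln x < (p - 1) * (x^-1 - 1) by rewrite ltr_pM2l// subr_gt0.
have : z / x - 1 + (p - 1) * (x^-1 - 1) = 0 by rewrite /z; field; lra.
lra.
Qed.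

(** The equality case of Jensen's inequality: the tangent of the power function at the mean [m]
    averages to [m ^ p], so [u] and [v] must both sit at the point of tangency. *)
Lemma powR_strictly_convex (R : realType) (p t u v : R) :
    1 < p -> 0 < t < 1 -> 0 <= u -> 0 <= v ->
    t * u `^ p + (1 - t) * v `^ p <= (t * u + (1 - t) * v) `^ p ->
  u = v.
Proof.
move=> p1 /andP[t0 t1] u0 v0; set m := t * u + (1 - t) * v => h.
have m0 : 0 <= m by apply: addr_ge0; apply: mulr_ge0; lra.
(* The tangent at [m] is rescaled from the tangent at 1, which needs [m] nonzero. *)
have [mE|mN0] := eqVneq m 0.
  have ut : 0 <= t * u by apply: mulr_ge0; lra.
  have vt : 0 <= (1 - t) * v by apply: mulr_ge0; lra.
  have : t * u = 0 by move: mE; rewrite /m; lra.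
  have : (1 - t) * v = 0 by move: mE; rewrite /m; lra.
  move/eqP; rewrite mulf_eq0 subr_eq0 => /orP[|/eqP->]; first lra.
  move/eqP; rewrite mulf_eq0 => /orP[|/eqP->//]; lra.
have mgt0 : 0 < m by rewrite lt0r mN0.
have tangent w : 0 <= w -> m `^ p * (1 + p * (w / m - 1)) <= w `^ p ?= iff (w == m).
  move=> w0; have wE : w `^ p = m `^ p * (w / m) `^ p.
    by rewrite -powRM ?divr_ge0// mulrCA divff// mulr1.
  have [->|wm] := eqVneq w m.
    by rewrite divff// subrr mulr0 addr0 mulr1; split; rewrite ?eqxx.
  apply/leifP; rewrite wE ltr_pM2l ?powR_gt0// powR_gt_tangent ?divr_ge0//.
  by rewrite -subr_eq0 -(mulfV mN0) -mulrBl mulf_neq0 ?invr_eq0// subr_eq0.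
have [uT uE] := tangent _ u0; have [vT vE] := tangent _ v0.
move: uT vT uE vE h; set a := _ * (1 + _); set b := _ * (1 + p * (v / _ - _)).
have : t * a + (1 - t) * b = m `^ p.
  have -> : t * a + (1 - t) * b = m `^ p * (1 + p * (m / m - 1)).
    by rewrite /a /b; move: (m `^ p) m^-1 => M i; rewrite /m; ring.
  by rewrite divff// subrr mulr0 addr0 mulr1.
move: a b (u `^ p) (v `^ p) (m `^ p) => a b U V M abM aU bV uE vE h.
have Ut : t * a <= t * U by rewrite ler_pM2l.
have Vt : (1 - t) * b <= (1 - t) * V by rewrite ler_pM2l ?subr_gt0.
have : t * a = t * U by lra.
move/(mulfI (lt0r_neq0 t0))/eqP; rewrite uE => /eqP->.
have : (1 - t) * b = (1 - t) * V by lra.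
move/mulfI; rewrite subr_eq0 gt_eqF// => /(_ isT)/eqP; rewrite vE => /eqP->//.
Qed.

(** As [M] is finite it can be subtracted: the nonnegative terms [h n - g n] sum to 0, and each is
    bounded by the sum. *)
Lemma eq_nneseries_le (R : realType) (g h : nat -> R) (M : R) :
    (forall n, 0 <= g n <= h n) ->
    (\sum_(n <oo) (g n)%:E = M%:E)%E -> (\sum_(n <oo) (h n)%:E = M%:E)%E ->
  g = h.
Proof.
move=> gh gM hM; have d0 n : 0 <= h n - g n.
  by have /andP[_] := gh n; rewrite subr_ge0.
have g0 n : 0 <= g n by have /andP[] := gh n.
have : (\sum_(n <oo) ((g n)%:E + (h n - g n)%:E) = M%:E)%E.
  by rewrite -hM; apply: eq_eseriesr => n _; rewrite -EFinD subrKC.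
rewrite nneseriesD => [|i _ _|i _ _]; rewrite ?lee_fin// gM => dM.
apply/funext => n; apply/eqP; rewrite eq_sym -subr_eq0 eq_le d0 andbT -lee_fin.
have {dM} <- : (\sum_(k <oo) (h k - g k)%:E = 0%:E)%E.
  move: dM; have : (0 <= \sum_(k <oo) (h k - g k)%:E)%E.
    by apply: nneseries_ge0 => k _ _; rewrite lee_fin.
  move: (\sum_(k <oo) _)%E => [r|//|//]; rewrite lee_fin -EFinD => r0 [rE].
  by congr (_%:E); lra.
apply: le_trans (nneseries_lim_ge n.+1 _) => [|k _ _]; last by rewrite lee_fin.
by rewrite big_nat_recr//= leeDr// sume_ge0// => k _; rewrite lee_fin.
Qed.

Lemma lpsum_normX (R : realType) (p : R) (p1 : 1 <= p)
    (E : nat -> completeNormedModType R) (x : lpsum p1 E) :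
  (\sum_(n <oo) (`|x n| `^ p)%:E)%E = (`|x| `^ p)%:E.
Proof.
have p0 : 0 < p by exact: (lt_le_trans ltr01 p1).
rewrite -poweR_EFin lpsum_normrE lpsum_normE /lpn -poweRrM mulVf ?gt_eqF//.
by rewrite poweRe1// lpn_sum_ge0.
Qed.

Lemma lpsum_coord_le (R : realType) (p : R) (p1 : 1 <= p)
    (E : nat -> completeNormedModType R) (x : lpsum p1 E) n : `|x n| <= `|x|.
Proof.
rewrite -lee_fin lpsum_normrE lpsum_normE.
exact: (@lpn_coord _ _ p1 (fun k => `|x k|)).
Qed.

Lemma lpsum_norm_le (R : realType) (p : R) (p1 : 1 <= p)
    (E F : nat -> completeNormedModType R) (x : lpsum p1 E) (y : lpsum p1 F)
    (a : R) :
  0 <= a -> (forall n, `|x n| <= a * `|y n|) -> `|x| <= a * `|y|.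
Proof.
move=> a0 xy; rewrite -lee_fin EFinM !lpsum_normrE !lpsum_normE -lpnZ//.
by apply: lpn_le => // n; rewrite normr_ge0/=.
Qed.

Lemma lpsum_norm_eq (R : realType) (p : R) (p1 : 1 <= p)
    (E F : nat -> completeNormedModType R) (x : lpsum p1 E) (y : lpsum p1 F)
    (a : R) :
  0 <= a -> (forall n, `|x n| = a * `|y n|) -> `|x| = a * `|y|.
Proof.
move=> a0 xy; apply: EFin_inj; rewrite EFinM !lpsum_normrE !lpsum_normE -lpnZ//.
by congr lpn; apply/funext => n; exact: xy.
Qed.

Lemma lpsum_coordD (R : realType) (p : R) (p1 : 1 <= p)
    (E : nat -> completeNormedModType R) (x y : lpsum p1 E) n :
  (x + y) n = x n + y n.
Proof. by []. Qed.

(** After scaling to unit vectors [u], [v], [w], monotonicity and convexity give [w ^ p <= (t u + (1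
    - t) v) ^ p <= t u ^ p + (1 - t) v ^ p] termwise. Both ends sum to 1, so equality holds in every
    term, and strict convexity yields [u n = v n = w n]. *)
Lemma lp_collinear (R : realType) (p : R) (a b c : nat -> R) (A B : R) n :
    1 < p -> 0 < A -> 0 < B ->
    (forall k, 0 <= a k) -> (forall k, 0 <= b k) ->
    (forall k, 0 <= c k <= a k + b k) ->
    (\sum_(k <oo) (a k `^ p)%:E = (A `^ p)%:E)%E ->
    (\sum_(k <oo) (b k `^ p)%:E = (B `^ p)%:E)%E ->
    (\sum_(k <oo) (c k `^ p)%:E = ((A + B) `^ p)%:E)%E ->
  A * c n = (A + B) * a n.
Proof.
move=> p1 A0 B0 a0 b0 cab aA bB cAB; have p0 : 0 < p by exact: lt_trans p1.
have AB0 : 0 < A + B by rewrite addr_gt0.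
have c0 k : 0 <= c k by have /andP[] := cab k.
pose t := A / (A + B).
have t0 : 0 < t by rewrite divr_gt0.
have tE : 1 - t = B / (A + B) by rewrite /t; field; lra.
have t1 : 0 < 1 - t by rewrite tE divr_gt0.
pose u k := a k / A; pose v k := b k / B; pose w k := c k / (A + B).
have u0 k : 0 <= u k by rewrite divr_ge0// ltW.
have v0 k : 0 <= v k by rewrite divr_ge0// ltW.
have w0 k : 0 <= w k by rewrite divr_ge0// ltW.
have unit_series (z : nat -> R) (Z : R) : (forall k, 0 <= z k) -> 0 < Z ->
    (\sum_(k <oo) (z k `^ p)%:E = (Z `^ p)%:E)%E ->
    (\sum_(k <oo) ((z k / Z) `^ p)%:E = 1%:E)%E.
  move=> z0 Z0 zZ; have ZV0 : 0 <= Z^-1 by rewrite invr_ge0 ltW.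
  under eq_eseriesr do rewrite powRM// mulrC EFinM.
  rewrite nneseriesZl => [|k _]; last by rewrite lee_fin powR_ge0.
  by rewrite zZ -EFinM -powRM ?(ltW Z0)// mulVf ?gt_eqF// powR1.
have wuv k : w k <= t * u k + (1 - t) * v k.
  have -> : t * u k + (1 - t) * v k = (a k + b k) / (A + B).
    by rewrite tE /t /u /v; field; lra.
  by rewrite ler_pM2r ?invr_gt0//; have /andP[] := cab k.
have step1 k : w k `^ p <= (t * u k + (1 - t) * v k) `^ p.
  by apply: ge0_ler_powR; rewrite ?nnegrE ?(ltW p0)// (le_trans (w0 k)).
have step2 k : (t * u k + (1 - t) * v k) `^ p
    <= t * u k `^ p + (1 - t) * v k `^ p.
  have t1' : t <= 1 by lra.
  have := @convex_powR R p (ltW p1) (Itv01 (ltW t0) t1') (u k) (v k).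
  by rewrite !inE/= !in_itv/= !u0 !v0 !convRE/= => /(_ isT isT).
have wE : (fun k => w k `^ p) = (fun k => t * u k `^ p + (1 - t) * v k `^ p).
  apply: (@eq_nneseries_le _ _ _ 1).
  - by move=> k; rewrite powR_ge0 (le_trans (step1 k)).
  - exact: unit_series.
  under eq_eseriesr do rewrite EFinD !EFinM.
  rewrite nneseriesD; last 2 first.
  - by move=> k _ _; rewrite -EFinM lee_fin mulr_ge0 ?powR_ge0// ltW.
  - by move=> k _ _; rewrite -EFinM lee_fin mulr_ge0 ?powR_ge0// ltW.
  rewrite !nneseriesZl => [|k _|k _]; rewrite ?lee_fin ?powR_ge0//.
  by rewrite !unit_series// !mule1 -EFinD subrKC.
have wn : w n `^ p = t * u n `^ p + (1 - t) * v n `^ p := congr1 (@^~ n) wE.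
have uv : u n = v n.
  have t01 : 0 < t < 1 by rewrite t0 -subr_gt0.
  by apply: (powR_strictly_convex p1 t01) => //; rewrite -wn.
have : w n = u n.
  have : w n `^ p = u n `^ p by rewrite wn -uv; ring.
  move=> /(congr1 (@powR R ^~ p^-1)).
  by rewrite -!powRrM mulfV ?gt_eqF// !powRr1.
rewrite /w /u => /eqP.
by rewrite eqr_div ?lt0r_neq0// => /eqP; rewrite mulrC => ->; rewrite mulrC.
Qed.

Lemma lpsum_collinear (R : realType) (p : R) (p1 : 1 < p)
    (E : nat -> completeNormedModType R) (x y : lpsum (ltW p1) E) n :
  `|x + y| = `|x| + `|y| -> `|x| * `|(x + y) n| = `|x + y| * `|x n|.
Proof.
move=> xyE.
have [->|x0] := eqVneq x 0; first by rewrite !normr0 mul0r mulr0.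
have [->|y0] := eqVneq y 0; first by rewrite addr0.
rewrite xyE; apply: (@lp_collinear R p (fun k => `|x k|) (fun k => `|y k|)
  (fun k => `|(x + y) k|)) => //; rewrite ?normr_gt0 -?xyE ?lpsum_normX//.
by move=> k; rewrite normr_ge0 ler_normD.
Qed.

(** * Gluing Fréchet embeddings *)

Lemma ell_infty_norm_le (R : realType) (n : nat) (x : ell_infty R n) (e : R) :
  0 <= e -> (forall i, `|x ord0 i| <= e) -> `|x| <= e.
Proof.
move=> e0 xe; rewrite [leLHS]mx_normrE; apply: bigmax_le => // -[i j] _ /=.
by rewrite ord1.
Qed.

Lemma ell_infty_coord_le (R : realType) (n : nat) (x : ell_infty R n) i :
  `|x ord0 i| <= `|x|.
Proof.
rewrite [leRHS]mx_normrE.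
exact: (le_bigmax _ (fun ij => `|x ij.1 ij.2|) (ord0, i)).
Qed.

Lemma ell_infty_norm_attained (R : realType) (n : nat) (x : ell_infty R n) :
  `|x| != 0 -> exists i, `|x ord0 i| = `|x|.
Proof.
move=> /mx_norm_neq0 [[i j]]; rewrite (ord1 i) => /= e.
by exists j; exact: esym e.
Qed.

Lemma mdist_distD (R : realType) (A : metricType R) (x y z : A) :
  `|mdist x z - mdist y z| <= mdist x y.
Proof.
have := metric_triangle x y z; have := metric_triangle y x z.
by rewrite (metric_sym y x) ler_norml; lra.
Qed.

(* Fréchet's embedding u |-> (d(u, a_i) - d(o, a_i))_i, where the a_i
   enumerate S: the coordinate a_i = u gives the isometry. *)
Lemma frechet_embedding (R : realType) (A : metricType R) (o : A) (S : set A) :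
  finite_set S -> exists N, forall n, (N <= n)%N ->
  exists T : A -> ell_infty R n.+1,
  [/\ T o = 0, forall u v, `|T u - T v| <= mdist u v &
      forall u v, S u -> `|T u - T v| = mdist u v].
Proof.
move=> /finite_seqP[s ->]; exists (size s) => n sn.
pose T u : ell_infty R n.+1 :=
  \row_(i < n.+1) (mdist u (nth o s i) - mdist o (nth o s i)).
have TE u v i : (T u - T v) ord0 i = mdist u (nth o s i) - mdist v (nth o s i).
  by rewrite !mxE; ring.
have T1 u v : `|T u - T v| <= mdist u v.
  apply: ell_infty_norm_le => [|i]; first exact: mdist_ge0.
  by rewrite TE mdist_distD.
exists T; split => // [|u v /= us].
  by apply/rowP => i; rewrite !mxE subrr.
apply/eqP; rewrite eq_le T1 /=.
have un : (index u s < n.+1)%N by rewrite ltnS (leq_trans (index_size _ _)).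
apply: le_trans (ell_infty_coord_le (T u - T v) (Ordinal un)).
rewrite TE /= nth_index// mdistxx sub0r normrN metric_sym.
exact: ler_norm.
Qed.

(* The n-th map T n is scaled by c u n; the deviation from a similarity is
   governed by the variation of c. *)
Lemma lpsum_glue (R : realType) (p : R) (p1 : 1 <= p) (A : metricType R) (o : A)
    (E : nat -> completeNormedModType R) (T : forall n, A -> E n)
    (c : A -> lpsum p1 (fun=> R^o)) :
    (forall n, T n o = 0) ->
    (forall n u v, `|T n u - T n v| <= mdist u v) ->
  exists f : A -> lpsum p1 E, forall u v,
    (forall n, c u n != 0 -> `|T n u - T n v| = mdist u v) ->
    `| `|f u - f v| - `|c u| * mdist u v | <= `|c u - c v| * mdist o v.
Proof.
move=> To T1.
have norm_T n u : `|T n u| <= mdist o u.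
  by rewrite metric_sym -[T n u]subr0 -(To n) T1.
have glue (w : lpsum p1 (fun=> R^o)) (M : R) (x : forall n, E n) : 0 <= M ->
    (forall n, `|x n| <= M) ->
    exists y : lpsum p1 E, forall n, y n = (w n : R) *: x n.
  move=> M0 xM.
  have h : (lpn p (fun n => `|(w n : R) *: x n|)%R < +oo)%E.
    have := lpcoordP (M *: w); apply: le_lt_trans.
    apply: lpn_le => // n; rewrite normr_ge0/= !normrZ mulrC.
    by rewrite (ger0_norm M0); apply: ler_wpM2r; [exact: normr_ge0|exact: xM].
  by exists (LpSum p1 h).
have /choice[f fE] u :
    exists y : lpsum p1 E, forall n, y n = (c u n : R) *: T n u.
  exact: (glue _ _ _ (mdist_ge0 o u) (norm_T ^~ u)).
exists f => u v Tc.
have [a aE] := glue (c u) _ (fun n => T n u - T n v)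
  (mdist_ge0 u v) (fun n => T1 n u v).
have [b bE] := glue (c u - c v) _ (fun n => T n v)
  (mdist_ge0 o v) (norm_T ^~ v).
(* Here [a] is [c u] times [T u - T v], of norm exactly [|c u| d(u, v)] since [T n] is isometric at
   [u] wherever [c u n] is nonzero; [b] is the error, [c u - c v] times [T v]. *)
have -> : f u - f v = a + b.
  apply: lpsum_ext => n; rewrite lpsum_coordB lpsum_coordD !fE aE bE.
  by rewrite lpsum_coordB scalerBl scalerBr addrA subrK.
have -> : `|c u| * mdist u v = `|a|.
  rewrite mulrC; apply/esym/lpsum_norm_eq => [|n]; first exact: mdist_ge0.
  rewrite aE normrZ mulrC; have [->|cn] := eqVneq (c u n) 0.
    by rewrite normr0 !mulr0.
  by rewrite Tc.
have : `|b| <= `|c u - c v| * mdist o v.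
  rewrite mulrC; apply: lpsum_norm_le => [|n]; first exact: mdist_ge0.
  by rewrite bE normrZ mulrC; apply: ler_wpM2r; [exact: normr_ge0|exact: norm_T].
apply: le_trans; apply: le_trans (ler_dist_dist _ _) _.
by rewrite addrC addKr.
Qed.

(** * A Lipschitz path on the unit sphere of l_p *)

(** Changing the vector and changing the scalar each cost at most [|x - y| / |x|], so a lower bound
    on the norm of [x] alone suffices. *)
Lemma normalize_lipschitz (R : realType) (V : normedModType R) (x y : V) (a : R) :
  0 < a -> a <= `|x| -> y != 0 ->
  `| `|x|^-1 *: x - `|y|^-1 *: y | <= 2 / a * `|x - y|.
Proof.
move=> a0 ax y0; have x0 : 0 < `|x| by exact: lt_le_trans ax.
have {}y0 : 0 < `|y| by rewrite normr_gt0.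
have -> : `|x|^-1 *: x - `|y|^-1 *: y =
    `|x|^-1 *: (x - y) + (`|x|^-1 - `|y|^-1) *: y.
  by rewrite scalerBr scalerBl addrA subrK.
apply: le_trans (ler_normD _ _) _; rewrite !normrZ ger0_norm ?invr_ge0//.
have -> : `| `|x|^-1 - `|y|^-1 | * `|y| = `|x|^-1 * `| `|y| - `|x| |.
  rewrite -{2}(ger0_norm (normr_ge0 y)) -normrM -{2}[`|x|^-1]ger0_norm ?invr_ge0//.
  by rewrite -normrM; congr `| _ |; field; lra.
have h : `|x|^-1 * `| `|y| - `|x| | <= `|x|^-1 * `|x - y|.
  by rewrite ler_pM2l ?invr_gt0// distrC ler_dist_dist.
apply: le_trans (lerD (lexx _) h) _.
rewrite -mulrDl mulr_natl mulr2n; apply: ler_wpM2r => //.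
by apply: lerD; rewrite lef_pV2.
Qed.

Definition polygon (R : realType) (V : normedModType R) (e : nat -> V) (t : R) : V :=
  let k := Num.trunc t in e k + (t - k%:R) *: (e k.+1 - e k).

Section polygon.
Context (R : realType) (V : normedModType R) (e : nat -> V)
  (e1 : forall k, `|e k| = 1).


Let step k : `|e k.+1 - e k| <= 2.
Proof. by apply: le_trans (ler_normB _ _) _; rewrite !e1. Qed.

Lemma polygon_norm_le (t : R) : 0 <= t -> `|polygon e t| <= 1.
Proof.
move=> /truncn_itv; rewrite /polygon -natr1; set k := Num.trunc t => /andP[kt tk].
have -> : e k + (t - k%:R) *: (e k.+1 - e k) =
    (1 - (t - k%:R)) *: e k + (t - k%:R) *: e k.+1.
  by rewrite scalerBr [(1 - _) *: _]scalerBl scale1r addrA addrAC.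
apply: le_trans (ler_normD _ _) _; rewrite !normrZ !e1 !ger0_norm; lra.
Qed.

Lemma polygon_lipschitz (s t : R) :
  0 <= s -> s <= t -> `|polygon e t - polygon e s| <= 2 * (t - s).
Proof.
move=> s0 st; have t0 : 0 <= t by exact: le_trans st.
have := polygon_norm_le t0; have := polygon_norm_le s0.
have := truncn_itv t0; have := truncn_itv s0; have := le_truncn st.
rewrite /polygon; move: (Num.trunc s) (Num.trunc t) => k l.
rewrite leq_eqVlt => /orP[/eqP<- |].
  move=> _ _ _ _; rewrite opprD addrACA subrr add0r -scalerBl.
  have -> : t - k%:R - (s - k%:R) = t - s by ring.
  rewrite normrZ mulrC ger0_norm ?subr_ge0//.
  by apply: ler_wpM2r; rewrite ?step// subr_ge0.
rewrite leq_eqVlt => /orP[/eqP<- |kl].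
  rewrite -[k.+2%:R]natr1 -![k.+1%:R]natr1 => /andP[ks sk] /andP[lt tl] _ _.
  have -> : e k.+1 + (t - (k%:R + 1)) *: (e k.+2 - e k.+1) -
      (e k + (s - k%:R) *: (e k.+1 - e k)) =
      (t - (k%:R + 1)) *: (e k.+2 - e k.+1) + (k%:R + 1 - s) *: (e k.+1 - e k).
    have -> : k%:R + 1 - s = 1 - (s - k%:R) by lra.
    by rewrite [(1 - _) *: _]scalerBl scale1r [- (e k + _)]opprD addrACA [RHS]addrCA.
  have -> : 2 * (t - s) = (t - (k%:R + 1)) * 2 + (k%:R + 1 - s) * 2 by ring.
  apply: le_trans (ler_normD _ _) _; rewrite !normrZ !ger0_norm; try lra.
  by apply: lerD; apply: ler_wpM2l; rewrite ?step//; lra.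
(* Between nonadjacent edges [t - s] exceeds 1, and two points of the unit ball are at distance at
   most 2. *)
move=> /andP[_ sk] /andP[lt _] Ps Pt.
have kl' : k.+1%:R + 1 <= l%:R :> R by rewrite natr1 ler_nat.
apply: le_trans (ler_normB _ _) _; lra.
Qed.

End polygon.

Section basis.
Context (R : realType) (p : R) (p1 : 1 <= p).
Local Notation L := (lpsum p1 (fun=> R^o)).

Lemma lpn_delta n : lpn p (fun k => `|(k == n)%:R : R^o|)%R = 1%:E.
Proof.
have p0 : p != 0 by rewrite gt_eqF// (lt_le_trans ltr01).
rewrite /lpn (nneseries_split 0 n.+1) => [|k _]; last by rewrite lee_fin powR_ge0.
rewrite add0n [X in (_ + X)%E]eseries0 ?adde0; last first.
  by move=> k nk _; rewrite gtn_eqF// normr0 powR0.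
rewrite big_nat_recr//= big1_seq ?add0e => [|k /andP[_]]; last first.
  by rewrite mem_index_iota => /andP[_ kn]; rewrite ltn_eqF// normr0 powR0.
by rewrite eqxx normr1 powR1 poweR1r.
Qed.

Lemma lpn_delta_fin n : (lpn p (fun k => `|(k == n)%:R : R^o|)%R < +oo)%E.
Proof. by rewrite lpn_delta ltey. Qed.

Definition lpdelta n : L := LpSum p1 (lpn_delta_fin n).

Lemma lpdelta_norm n : `|lpdelta n| = 1.
Proof. by apply: EFin_inj; rewrite lpsum_normrE lpsum_normE lpn_delta. Qed.

Let P (N : nat -> nat) := polygon (lpdelta \o N).

Lemma polygon_lpdeltaE N t n (k := Num.trunc t) :
  P N t n = (1 - (t - k%:R)) * (n == N k)%:R + (t - k%:R) * (n == N k.+1)%:R.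
Proof.
have -> : P N t n = (n == N k)%:R +
    (t - k%:R) * ((n == N k.+1)%:R - (n == N k)%:R) by [].
by ring.
Qed.

(* A point of an edge of the polygon has a coordinate at least 1/2. *)
Lemma polygon_lpdelta_ge N t : injective N -> 0 <= t -> 2^-1 <= `|P N t|.
Proof.
move=> Ni /truncn_itv; set k := Num.trunc t; rewrite -natr1 => /andP[kt tk].
have [tk2|tk2] := leP (t - k%:R) 2^-1.
- apply: le_trans (lpsum_coord_le _ (N k)); rewrite polygon_lpdeltaE.
  rewrite eqxx (inj_eq Ni) ltn_eqF// mulr0 addr0 mulr1.
  by apply: le_trans (ler_norm _); rewrite -/k; lra.
- apply: le_trans (lpsum_coord_le _ (N k.+1)); rewrite polygon_lpdeltaE.
  rewrite eqxx (inj_eq Ni) gtn_eqF// mulr0 add0r mulr1.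
  by apply: le_trans (ler_norm _); rewrite -/k; lra.
Qed.

(** The polygon through the vectors [lpdelta (N k)] keeps norm at least 1/2, so pushing it onto the
    sphere multiplies its Lipschitz constant 2 by at most 4. Only the two coordinates of the current
    edge are active, so coordinate [N k] matters only before time [k + 1]. *)
Lemma lp_sphere_path (N : nat -> nat) : injective N ->
  exists g : R -> L, [/\ forall t, 0 <= t -> `|g t| = 1,
    forall s t, 0 <= s -> s <= t -> `|g t - g s| <= 8 * (t - s) &
    forall t n, 0 <= t -> g t n != 0 -> exists2 k, n = N k & t < k.+1%:R].
Proof.
move=> Ni; exists (fun t => `|P N t|^-1 *: P N t).
have P0 t : 0 <= t -> P N t != 0.
  by move=> t0; rewrite -normr_gt0 (lt_le_trans _ (polygon_lpdelta_ge Ni t0)).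
split.
- move=> t t0; rewrite normrZ ger0_norm ?invr_ge0//.
  by rewrite mulVf// normr_eq0 P0.
- move=> s t s0 st; have t0 : 0 <= t by exact: le_trans st.
  have h2 : 0 < 2^-1 :> R by rewrite invr_gt0.
  apply: le_trans (normalize_lipschitz h2 (polygon_lpdelta_ge Ni t0) (P0 _ s0)) _.
  have -> : 8 * (t - s) = 2 / 2^-1 * (2 * (t - s)) by field.
  rewrite ler_pM2l ?divr_gt0//.
  by apply: polygon_lipschitz => // k; exact: lpdelta_norm.
- move=> t n t0; have /andP[_ tk] := truncn_itv t0.
  have -> : (`|P N t|^-1 *: P N t) n = `|P N t|^-1 * P N t n by [].
  rewrite polygon_lpdeltaE mulf_eq0 negb_or => /andP[_].
  have [->|_] := eqVneq n (N (Num.trunc t)).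
    by exists (Num.trunc t).
  have [->|_] := eqVneq n (N (Num.trunc t).+1).
    by exists (Num.trunc t).+1; rewrite // (lt_le_trans tk)// ler_nat.
  by rewrite !mulr0 addr0 eqxx.
Qed.

End basis.

(** * The almost isometric embedding *)

(** The infimum of the admissible constants is attained: every admissible [r] is at most [inf Q], so
    [inf Q] serves as [r] for all constants at once, and the upper bounds pass to the infimum. *)
Lemma bilipschitz_distortion (R : realType) (A : metricType R)
    (X : normedModType R) (S : set A) (C : R) (f : A -> X) :
  bilipschitz_with S C f -> exists D, distortion_is S f D /\ D <= C.
Proof.
move=> fC; pose CS := [set c | bilipschitz_with S c f].
have CS1 : lbound CS 1 by move=> c [].
have hCS : has_inf CS by split; [exists C|exists 1].
have infC c : bilipschitz_with S c f -> inf CS <= c.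
  by move=> fc; apply: ge_inf => //; exists 1.
have inf1 : 1 <= inf CS by apply: lb_le_inf => //; exists C.
exists (inf CS); split; last exact: infC.
split; last exact: infC.
split=> //; pose Q := [set q | exists u v,
  [/\ S u, S v, 0 < mdist u v & q = `|f u - f v| / mdist u v]].
have Q_ge r c : (forall u v, S u -> S v ->
    r * mdist u v <= `|f u - f v| <= r * c * mdist u v) -> lbound Q r.
  move=> h _ [u [v [Su Sv uv ->]]].
  by rewrite ler_pdivlMr//; have /andP[] := h _ _ Su Sv.
have [[q0 Q0]|Q0] := pselect (Q !=set0); last first.
  exists 1 => // u v Su Sv; have uv : mdist u v = 0.
    apply/eqP; rewrite eq_le mdist_ge0 andbT leNgt; apply/negP => uv.
    by apply: Q0; exists (`|f u - f v| / mdist u v), u, v.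
  by rewrite uv (mdist_positivity _ _ uv) subrr normr0 !mulr0 lexx.
have [_ [r0 r00 h0]] := fC.
have r_le_inf r c : (forall u v, S u -> S v ->
    r * mdist u v <= `|f u - f v| <= r * c * mdist u v) -> r <= inf Q.
  by move=> h; apply: lb_le_inf; [exists q0|exact: Q_ge h].
have Qgt0 : 0 < inf Q by exact: lt_le_trans (r_le_inf _ _ h0).
exists (inf Q) => // u v Su Sv.
have [uv|] := ltP 0 (mdist u v); last first.
  rewrite le_eqVlt ltNge mdist_ge0 orbF => /eqP uv.
  by rewrite uv (mdist_positivity _ _ uv) subrr normr0 !mulr0 lexx.
apply/andP; split.
  rewrite -ler_pdivlMr//; apply: ge_inf; last by exists u, v.
  by exists r0; exact: Q_ge h0.
have -> : inf Q * inf CS * mdist u v = inf CS * (inf Q * mdist u v) by ring.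
rewrite -ler_pdivrMr ?mulr_gt0//.
apply: lb_le_inf => [|c [c1 [r r1 h]]]; first by exists C.
rewrite ler_pdivrMr ?mulr_gt0//; have /andP[_ /le_trans] := h _ _ Su Sv; apply.
have -> : c * (inf Q * mdist u v) = inf Q * c * mdist u v by ring.
by rewrite ler_pM2r// ler_pM2r ?(lt_le_trans ltr01)//; exact: r_le_inf h.
Qed.

(** Index [N k] is reserved for [B k]; injectivity of [N] avoids conflicts, and the remaining
    indices carry the zero map. *)
Lemma frechet_family (R : realType) (A : metricType R) (o : A) (B : nat -> set A) :
    (forall k, finite_set (B k)) ->
  exists (N : nat -> nat) (T : forall n, A -> ell_infty R n.+1),
  [/\ injective N, forall n, T n o = 0,
      forall n u v, `|T n u - T n v| <= mdist u v &
      forall k u v, B k u -> `|T (N k) u - T (N k) v| = mdist u v].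
Proof.
move=> Bfin.
have /choice[M MP] k := frechet_embedding o (Bfin k).
(* The sum ensures [M k <= N k], and the summand [k] makes [N] strictly increasing. *)
pose N k := (k + \sum_(i < k.+1) M i)%N.
have MN k : (M k <= N k)%N.
  by rewrite /N big_ord_recr/= addnA leq_addl.
have Nlt : {homo N : i j / (i < j)%N}.
  apply: homo_ltn => [i j k|i]; first exact: ltn_trans.
  by rewrite /N [X in (_ < _ + X)%N]big_ord_recr/= addSn ltnS addnA leq_addr.
have Ninj : injective N.
  by move=> i j; case: (ltngtP i j) => // /Nlt; rewrite ltn_neqAle => /andP[/eqP]; congruence.
have TP n : exists T : A -> ell_infty R n.+1, [/\ T o = 0,
    forall u v, `|T u - T v| <= mdist u v &
    forall k u v, N k = n -> B k u -> `|T u - T v| = mdist u v].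
  have [[k <-]|Nn] := pselect (exists k, N k = n).
    have [T [T0 T1 TB]] := MP k _ (MN k).
    by exists T; split => // j u v /Ninj ->; exact: TB.
  exists (fun=> 0); split => // [u v|k u v kn]; first by rewrite subrr normr0 mdist_ge0.
  by case: Nn; exists k.
exists N, (fun n => projT1 (cid (TP n))); split => // [n|n|k u v].
- by have [] := projT2 (cid (TP n)).
- by have [] := projT2 (cid (TP n)).
- by have [_ _] := projT2 (cid (TP (N k))); apply.
Qed.

(** Gluing along a constant unit vector makes the error term vanish. *)
Lemma finite_isometric_embedding (R : realType) (p : R) (p1 : 1 <= p)
    (A : metricType R) (o : A) (S : set A) : finite_set S ->
  exists f : A -> lpsum p1 (fun n => ell_infty R n.+1), bilipschitz_with S 1 f.
Proof.
move=> Sfin; have [N [T [_ T0 T1 TS]]] := frechet_family o (fun=> Sfin).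
have [f fE] := lpsum_glue (fun=> lpdelta p1 (N 0)) T0 T1.
exists f; split => //; exists 1 => // u v Su _.
have : `| `|f u - f v| - mdist u v| <= 0.
  have /fE : forall n, lpdelta p1 (N 0%N) n != 0 -> `|T n u - T n v| = mdist u v.
    move=> n; have -> : lpdelta p1 (N 0%N) n = (n == N 0%N)%:R by [].
    by have [->|] := eqVneq n (N 0%N) => [_|]; [exact: TS|rewrite eqxx].
  by rewrite lpdelta_norm mul1r subrr normr0 mul0r.
by rewrite normr_le0 subr_eq0 => /eqP ->; rewrite !mul1r lexx.
Qed.

(** For [a = d(o, u)] and [b = d(o, v)]: the factor [d(o, v)] of the gluing error is absorbed by the
    slope of [ln (1 + x)], at most [1 / (1 + b)] from [b] on. *)
Lemma ln1D_lipschitz (R : realType) (a b : R) : 0 <= b -> b <= a ->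
  (ln (1 + a) - ln (1 + b)) * b <= a - b.
Proof.
move=> b0 ba; have b1 : 0 < 1 + b by lra.
have a1 : 0 < 1 + a by lra.
have h : ln (1 + a) - ln (1 + b) <= (a - b) / (1 + b).
  rewrite -ln_div ?posrE//.
  have -> : (1 + a) / (1 + b) = 1 + (a - b) / (1 + b) by field; lra.
  by apply: le_ln1Dx; rewrite (lt_le_trans (ltrN10 _))// divr_ge0//; lra.
apply: le_trans (ler_wpM2r b0 h) _.
rewrite -mulrA; apply: ler_piMr; first lra.
by rewrite mulrC ler_pdivrMr//; lra.
Qed.

(* Following a slow path on the unit sphere of l_p, in the time
   delta * ln (1 + d(o, u)), makes the map nearly a similarity at all scales. *)
Lemma locally_finite_embedding (R : realType) (p : R) (p1 : 1 <= p)
    (A : metricType R) (eps : R) : locally_finite A -> 0 < eps ->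
  exists f : A -> lpsum p1 (fun n => ell_infty R n.+1),
    bilipschitz_with [set: A] (1 + eps) f.
Proof.
move=> Afin eps0.
have eps1 : 1 <= 1 + eps by lra.
have [A0|/existsNP[ o _]] := pselect (A -> False).
  by exists (fun=> 0); split => //; exists 1 => // u; case: (A0 u).
(* [eta] solves [(1 + eta) / (1 - eta) = 1 + eps], and the 8 cancels the Lipschitz constant of the
   sphere path. *)
pose eta := eps / (eps + 2); pose delta := eta / 8.
have eta0 : 0 < eta by rewrite divr_gt0//; lra.
have delta0 : 0 < delta by rewrite divr_gt0.
pose tau (u : A) := delta * ln (1 + mdist o u).
have tau0 u : 0 <= tau u.
  by rewrite pmulr_rge0// ln_ge0// lerDl mdist_ge0.
pose B (k : nat) := [set u | tau u < k.+1%:R].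
(* Inverting [tau] places [B k] inside a ball around [o], where local finiteness applies. *)
have Bfin k : finite_set (B k).
  apply: sub_finite_set (Afin o (expR (k.+1%:R / delta))) => u /= Bu.
  rewrite ballEmdist/=; apply: (@lt_trans _ _ (1 + mdist o u)); first by rewrite ltrDr.
  have d0 : 0 < 1 + mdist o u by rewrite ltr_pwDl// mdist_ge0.
  by rewrite -[ltLHS]lnK// ltr_expR ltr_pdivlMr// mulrC.
have [N [T [Ninj T0 T1 TB]]] := frechet_family o Bfin.
have [g [g1 glip gN]] := lp_sphere_path p1 Ninj.
have [f fE] := lpsum_glue (g \o tau) T0 T1.
(* The point farther from [o] plays the role of [u], so that the error carries the smaller of the
   two distances to [o]. *)
have fle u v : mdist o v <= mdist o u ->
    `| `|f u - f v| - mdist u v| <= eta * mdist u v.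
  move=> vu; have /fE : forall n, g (tau u) n != 0 -> `|T n u - T n v| = mdist u v.
    by move=> n /gN[//|k -> uk]; exact: TB.
  rewrite /= g1// mul1r => /le_trans; apply.
  have tvu : tau v <= tau u.
    by rewrite ler_pM2l// ler_ln ?posrE ?lerD2l// ltr_pwDl// mdist_ge0.
  apply: le_trans (ler_wpM2r (mdist_ge0 o v) (glip _ _ (tau0 v) tvu)) _.
  have -> : 8 * (tau u - tau v) * mdist o v =
      eta * ((ln (1 + mdist o u) - ln (1 + mdist o v)) * mdist o v).
    by rewrite /tau /delta; field.
  rewrite ler_pM2l//; apply: le_trans (ln1D_lipschitz (mdist_ge0 o v) vu) _.
  by rewrite lerBlDl (metric_sym u v) metric_triangle.
have {}fle u v : `| `|f u - f v| - mdist u v| <= eta * mdist u v.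
  have [|/ltW] := leP (mdist o v) (mdist o u); first exact: fle.
  by rewrite [`|f u - _|]distrC [mdist u v]metric_sym; exact: fle.
exists f; split => //.
have eta1 : 0 < 1 - eta.
  have -> : 1 - eta = 2 / (eps + 2) by rewrite /eta; field; lra.
  by rewrite divr_gt0//; lra.
have etaE : (1 - eta) * (1 + eps) = 1 + eta by rewrite /eta; field; lra.
exists (1 - eta) => // u v _ _; rewrite etaE.
by have := fle u v; rewrite ler_norml => /andP[]; lra.
Qed.

(** * A space without isometric embedding *)

(** Two points of the ball of radius [w] at distance [2 * w] take the values [w] and [- w] in some
    coordinate, so their sign patterns differ. *)
Lemma ell_infty_equilateral_card (R : realType) (n : nat) (I : finType)
    (x : I -> ell_infty R n) (w : R) : 0 < w ->
    (forall i, `|x i| <= w) -> (forall i j, i != j -> `|x i - x j| = 2 * w) ->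
  (#|I| <= 2 ^ n)%N.
Proof.
move=> w0 xw xx; pose sign i := [ffun k : 'I_n => 0 < x i ord0 k].
suff /leq_card : injective sign by rewrite card_ffun card_bool card_ord.
move=> i j ij; apply: contraPP ij => /eqP /xx xij /ffunP ij.
have [|k] := @ell_infty_norm_attained _ _ (x i - x j); first by rewrite xij; lra.
have := le_trans (ell_infty_coord_le (x i) k) (xw i).
have := le_trans (ell_infty_coord_le (x j) k) (xw j).
have := ij k; rewrite !ffunE xij => /esym.
have -> : (x i - x j) ord0 k = x i ord0 k - x j ord0 k by rewrite !mxE.
move: (x i ord0 k) (x j ord0 k) => a b; rewrite !ler_norml.
case: (ltP 0 a) => a0 b0 /andP[b1 b2] /andP[a1 a2].
  by move/eqP; rewrite eqr_norml => /andP[/orP[/eqP|/eqP]]; lra.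
have {}b0 : b <= 0 by rewrite leNgt b0.
by move/eqP; rewrite eqr_norml => /andP[/orP[/eqP|/eqP]]; lra.
Qed.

(* Points m and n at different levels are at distance |level m - level n|, and
   distinct points of the same level are at distance 2. Level k consists of
   the 2^k numbers in [2^k - 1, 2^(k+1) - 1). *)
Definition level (n : nat) : nat := trunc_log 2 n.+1.

Definition layered_dist (m n : nat) : nat :=
  if m == n then 0%N else if level m == level n then 2%N
  else ((level m - level n) + (level n - level m))%N.

Lemma level_eq (k i : nat) : (i < 2 ^ k)%N -> level ((2 ^ k).-1 + i) = k.
Proof.
move=> ik; apply: trunc_log_eq => //.
by have := expn_gt0 2 k; rewrite expnS; lia.
Qed.

Lemma layered_dist_level (m n : nat) : level m != level n ->
  layered_dist m n = ((level m - level n) + (level n - level m))%N.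
Proof.
move=> lmn; have mn : m != n by apply: contraNneq lmn => ->.
by rewrite /layered_dist (negPf mn) (negPf lmn).
Qed.

Lemma layered_dist_sym m n : layered_dist m n = layered_dist n m.
Proof. by rewrite /layered_dist eq_sym [level m == _]eq_sym addnC. Qed.

(** The value 2 within a level is compatible with detours: leaving the level and coming back costs
    at least 1 + 1. *)
Lemma layered_dist_triangle k m n :
  (layered_dist m n <= layered_dist m k + layered_dist k n)%N.
Proof.
rewrite /layered_dist; have [->//|mn] := eqVneq m n.
have [mk|mk] := eqVneq m k; first by rewrite -mk (negPf mn) add0n.
have [kn|kn] := eqVneq k n; first by rewrite -kn addn0.
by do 3 case: eqP => ?; lia.
Qed.

(** A copy of [nat] whose parameter fixes the field in which the metric takes its values. *)
Definition layered (R : realType) : Type := nat.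

Section layered.
Context (R : realType).
HB.instance Definition _ := Choice.copy (layered R) nat.

Let dist (m n : layered R) : R := (layered_dist m n)%:R.

Let distxx m : dist m m = 0.
Proof. by rewrite /dist /layered_dist eqxx. Qed.

Let dist_pos m n : dist m n = 0 -> m = n.
Proof.
move=> /eqP; rewrite pnatr_eq0 /layered_dist; case: (eqVneq m n) => // _.
by case: (eqVneq (level m) (level n)) => [//|]; lia.
Qed.

Let dist_sym m n : dist m n = dist n m.
Proof. by rewrite /dist layered_dist_sym. Qed.

Let dist_triangle k m n : dist m n <= dist m k + dist k n.
Proof. by rewrite /dist -natrD ler_nat layered_dist_triangle. Qed.

HB.instance Definition _ :=
  isMetric.Build R (layered R) distxx dist_pos dist_sym dist_triangle.

Lemma layered_mdistE (m n : layered R) : mdist m n = (layered_dist m n)%:R.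
Proof. by []. Qed.

(** A ball bounds the levels of its points, and each level is finite. *)
Lemma layered_locally_finite : locally_finite (layered R).
Proof.
move=> a r; apply: (@sub_finite_set _ _ `I_(2 ^ (level a + Num.trunc r).+3)).
  move=> b; rewrite ballEmdist/= layered_mdistE => abr.
  have ab : (layered_dist a b <= Num.trunc r)%N.
    by rewrite -ltnS -(ltr_nat R) (lt_trans abr)// truncnS_gt.
  have lb : (level b <= (level a + Num.trunc r).+2)%N.
    by move: ab; rewrite /layered_dist; case: (eqVneq a b) => [<-|_];
      [lia|case: (eqVneq (level a) (level b)); lia].
  have : (b.+1 < 2 ^ (level b).+1)%N by exact: trunc_log_ltn.
  have : (2 ^ (level b).+1 <= 2 ^ (level a + Num.trunc r).+3)%N by rewrite leq_exp2l.
  lia.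
exact: finite_II.
Qed.

End layered.

(* On a geodesic triple the n-th coordinates are proportional to the distances,
   so two points of level k have n-th coordinates at distance 2w, where w is
   the n-th coordinate distance between points 0 and 1. Hence the n-th
   component contains arbitrarily large bounded 2w-equilateral sets. *)
Lemma layered_not_isometric (R : realType) (p : R) (p1 : 1 < p)
    (f : layered R -> lpsum (ltW p1) (fun n => ell_infty R n.+1)) (r : R) :
  0 < r -> ~ (forall u v, `|f u - f v| = r * mdist u v).
Proof.
move=> r0 fr; pose d := layered_dist.
have {}fr u v : `|f u - f v| = r * (d u v)%:R := fr u v.
have /existsNP[n n01] : ~ (forall n, (f 0%N - f 1%N) n = 0).
  move=> f01; have := fr 0%N 1%N.
  have -> : f 0%N - f 1%N = 0 by apply: lpsum_ext.
  by rewrite normr0 => /esym/eqP; rewrite mulf_eq0 gt_eqF// pnatr_eq0.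
pose N (u v : nat) := `|(f u - f v) n|.
have Nsym u v : N u v = N v u by rewrite /N !lpsum_coordB distrC.
have geodesic u z v : d u v = (d u z + d z v)%N ->
    (d u z)%:R * N u v = (d u v)%:R * N u z.
  move=> uzv; have fuv : f u - f v = (f u - f z) + (f z - f v).
    by rewrite addrA subrK.
  have := @lpsum_collinear _ _ p1 _ (f u - f z) (f z - f v) n.
  rewrite -fuv !fr uzv natrD mulrDr => /(_ erefl).
  rewrite -mulrDr -natrD -uzv -!mulrA => /(mulfI (lt0r_neq0 r0)).
  by [].
have w0 : 0 < N 0%N 1%N by rewrite normr_gt0; exact/eqP.
(* Level [k] has [2 ^ n.+2] points, too many for the sign patterns in dimension [n.+1]. The point
   [c] is the first of level [k.+1], a common midpoint of all pairs of distinct points of level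
   [k]. *)
set w := N _ _ in w0; pose k := n.+2; pose c := (2 ^ k.+1).-1.
pose s (i : 'I_(2 ^ k)) := ((2 ^ k).-1 + i)%N.
have lev0 : level 0 = 0%N by [].
have lev1 : level 1 = 1%N by [].
have levc : level c = k.+1 by rewrite -[c]addn0 level_eq// expn_gt0.
have levs i : level (s i) = k by rewrite level_eq.
have d01 : d 0%N 1%N = 1%N by [].
have d0c : d 0%N c = k.+1 by rewrite /d layered_dist_level lev0 levc.
have d1c : d 1%N c = k by rewrite /d layered_dist_level lev1 levc.
have d0s i : d 0%N (s i) = k by rewrite /d layered_dist_level lev0 levs.
have dsc i : d (s i) c = 1%N.
  rewrite /d layered_dist_level levs levc; last by rewrite ltn_eqF.
  by rewrite subSnn (eqP (leqnSn k)).
have dss i j : i != j -> d (s i) (s j) = 2%N.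
  by move=> ij; rewrite /d /layered_dist !levs eqxx eqn_add2l val_eqE (negPf ij).
have dC u v : d u v = d v u by exact: layered_dist_sym.
(* The geodesics [0, 1, c], then [c, s i, 0], then [s i, c, s j] carry the coordinate distance [w]
   from the pair [0, 1] up to level [k]. *)
have Nc : N 0%N c = k.+1%:R * w.
  have := geodesic 0%N 1%N c; rewrite d01 d0c d1c => /(_ erefl).
  by rewrite mul1r.
have Ns i : N (s i) c = w.
  have := geodesic c (s i) 0%N; rewrite !(dC c) !(dC _ 0%N) d0c d0s dsc.
  move=> /(_ erefl); rewrite mul1r Nsym Nc => /mulfI.
  by rewrite pnatr_eq0 => /(_ isT); rewrite Nsym.
have Nss i j : i != j -> N (s i) (s j) = 2 * w.
  move=> ij; have := geodesic (s i) c (s j); rewrite (dC c) !dsc dss//.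
  by move=> /(_ erefl); rewrite mul1r Ns.
suff : (2 ^ k <= 2 ^ n.+1)%N by rewrite leq_exp2l// ltnn.
rewrite -[leqLHS]card_ord.
apply: (ell_infty_equilateral_card (x := fun i => (f (s i) - f c) n) w0).
  by move=> i; rewrite -[leRHS](Ns i).
move=> i j ij; rewrite -(Nss i j ij) /N !lpsum_coordB; congr `| _ |.
by rewrite opprB addrA subrK.
Qed.

Unset Implicit Arguments.

Theorem corollary1p13 (R : realType) (p : R) (hp : 1 < p) :
  D_eq_plus (lpsum (ltW hp) (fun n : nat => ell_infty R n.+1)) 1.
Proof.
split=> [eps eps0 C A C1 Afin _|D1].
  have [f /bilipschitz_distortion [D [fD Dle]]] :=
    locally_finite_embedding (ltW hp) Afin eps0.
  exists f, D; split => //; apply: le_trans Dle _.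
  by rewrite ler_pMr//; lra.
have finite_embeds (S : set (layered R)) : finite_set S ->
    embeds_with_distortion_le S (lpsum (ltW hp) (fun n => ell_infty R n.+1)) 1.
  move=> /(finite_isometric_embedding (ltW hp) (0%N : layered R))[f].
  by move=> /bilipschitz_distortion[D [fD D1']]; exists f, D.
have [f [D [[[D_ge1 [r r0 fr]] _] D_le1]]] :=
  D1 1 (layered R) (lexx 1) (@layered_locally_finite R) finite_embeds.
(* A distortion of 1 turns the two bilipschitz bounds into an equality, making [f] a similarity of
   ratio [r]. *)
have D1E : D = 1 by lra.
apply: (layered_not_isometric (f := f) r0) => u v; apply/eqP.
by rewrite eq_le andbC; have := fr u v I I; rewrite D1E mulr1.
Qed.
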